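(* Let $R$ be an associative ring with identity. There is no simple Kleisli convolution representation of $R$.
   Context: All modules are unital left modules, ring homomorphisms are unital. Let $\mathbf 1=\{\bullet\}$, and for a finite set $X$ put $E_X=X\times X$. For a set $X$, $\mathcal M_{\mathbb Z}(X)$ is the free Abelian group of finite formal sums $\sum_{x\in X}a_x[x]$; $\mathscr M_{\mathbb Z}$ is the corresponding free Abelian group monad on $\mathsf{Set}$. A Kleisli arrow $f:X\rightsquigarrow Y$ is a map $f:X\to\mathcal M_{\mathbb Z}(Y)$. For finite $X$, $\mathbb H_{\mathbb Z}(X)=\mathrm{Hom}_{\mathsf{Kl}(\mathscr M_{\mathbb Z})}(\mathbf 1,E_X)$ is a ring with pointwise addition and Kleisli convolution as multiplication: if $f(\bullet)=\sum f_{i,j}[(i,j)]$ and $g(\bullet)=\sum g_{i,j}[(i,j)]$ then $(f\ast g)(\bullet)=\sum_{i,q}(\sum_j f_{i,j}g_{j,q})[(i,q)]$; its unit is $u_X(\bullet)=\sum_x[(x,x)]$. $\Phi_X:\mathbb H_{\mathbb Z}(X)\to\mathrm{Mat}_X(\mathbb Z)$, $f\mapsto(f_{i,j})$, is a ring isomorphism. A Kleisli convolution representation of $R$ is a pair $(X,\varrho)$ with $X$ a finite set and $\varrho:R\to\mathbb H_{\mathbb Z}(X)$ a unital ring homomorphism; the one on the empty set is the zero object. Its associated left $R$-module is $M_{\varrho}=\mathbb Z^{(X)}$ with action $r\cdot v=\Phi_X(\varrho(r))v$. A nonzero representation $(X,\varrho)$ is called simple if $M_{\varrho}$ is a simple left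 $R$-module. *)

(* Defs.v *)
From HB Require Import structures.
From mathcomp Require Import all_boot all_algebra.
From mathcomp Require Import freeg.

Set Implicit Arguments.
Unset Strict Implicit.
Unset Printing Implicit Defensive.

Import GRing.Theory.
Local Open Scope ring_scope.

(* Kleisli arrows X ~> Y of the free Abelian group monad, for a finite source
   X: finite functions rather than bare functions, so that the pointwise
   addition of ssralg applies to them.  [{freeg Y / int}] is the free Abelian
   group of finite formal integer combinations of elements of Y. *)
Definition kleisli_hom (X : finType) (Y : choiceType) : Type :=
  {ffun X -> {freeg Y / int}}.

(* H_Z(X): the Kleisli arrows from the one-point set to E_X = X * X. *)
Definition kconv (X : finType) : Type := kleisli_hom unit (X * X)%type.
HB.instance Definition _ (X : finType) :=
  GRing.Zmodule.on (kconv X).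

Section KleisliConvolution.
Context (X : finType).
Implicit Types f g h : kconv X.

(* Entries of the X-indexed integer matrix Phi_X(f). *)
Definition kconv_mx f (i j : X) : int := coeff (i, j) (f tt).

Definition kconv_one : kconv X :=
  [ffun _ : unit => \sum_(x : X) << (x, x) >>].

Definition kconv_mul f g : kconv X :=
  [ffun _ : unit => \sum_(i : X) \sum_(q : X)
     << (\sum_(j : X) kconv_mx f i j * kconv_mx g j q) *g (i, q) >>].

Lemma kconv_mx_inj f g : (forall i j, kconv_mx f i j = kconv_mx g i j) -> f = g.
Proof.
move=> fg; apply/ffunP => -[]; apply/eqP/freeg_eqP => -[i j]; exact: fg.
Qed.

Lemma kconv_mxD f g i j : kconv_mx (f + g) i j = kconv_mx f i j + kconv_mx g i j.
Proof. by rewrite /kconv_mx ffunE coeffD. Qed.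

Lemma kconv_mx1 i j : kconv_mx kconv_one i j = (i == j)%:R.
Proof.
rewrite /kconv_mx ffunE raddf_sum /= (bigD1 i) //= coeffU mul1r xpair_eqE eqxx /=.
rewrite big1 ?addr0 // => k ki.
by rewrite coeffU xpair_eqE (negbTE ki) mulr0.
Qed.

Lemma kconv_mxM f g i q :
  kconv_mx (kconv_mul f g) i q = \sum_(j : X) kconv_mx f i j * kconv_mx g j q.
Proof.
have coeffE i' q' a : coeff (i, q) << a *g (i', q') >> = a *+ ((i' == i) && (q' == q)).
  by rewrite coeffU xpair_eqE mulr_natr.
rewrite {1}/kconv_mx ffunE raddf_sum (bigD1 i) //= raddf_sum (bigD1 q) //=.
rewrite coeffE !eqxx mulr1n -addrA -[RHS]addr0; congr (_ + _).
rewrite !big1 ?addr0 // => [k ki|k kq]; last by rewrite coeffE (negbTE kq) andbF.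
by rewrite raddf_sum big1 // => l _; rewrite /= coeffE (negbTE ki).
Qed.

Lemma kconv_mulA : associative kconv_mul.
Proof.
move=> f g h; apply: kconv_mx_inj => i q; rewrite !kconv_mxM.
under eq_bigr do rewrite kconv_mxM mulr_sumr.
rewrite exchange_big /=; apply: eq_bigr => k _.
by rewrite kconv_mxM mulr_suml; apply: eq_bigr => j _; rewrite mulrA.
Qed.

Lemma kconv_mul1 : left_id kconv_one kconv_mul.
Proof.
move=> f; apply: kconv_mx_inj => i q; rewrite kconv_mxM (bigD1 i) //=.
rewrite kconv_mx1 eqxx mul1r big1 ?addr0 // => k ki.
by rewrite kconv_mx1 eq_sym (negbTE ki) mul0r.
Qed.

Lemma kconv_mulr1 : right_id kconv_one kconv_mul.
Proof.
move=> f; apply: kconv_mx_inj => i q; rewrite kconv_mxM (bigD1 q) //=.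
rewrite kconv_mx1 eqxx mulr1 big1 ?addr0 // => k kq.
by rewrite kconv_mx1 (negbTE kq) mulr0.
Qed.

Lemma kconv_mulDl : left_distributive kconv_mul +%R.
Proof.
move=> f g h; apply: kconv_mx_inj => i q.
rewrite kconv_mxD !kconv_mxM -big_split /=.
by apply: eq_bigr => j _; rewrite kconv_mxD mulrDl.
Qed.

Lemma kconv_mulDr : right_distributive kconv_mul +%R.
Proof.
move=> f g h; apply: kconv_mx_inj => i q.
rewrite kconv_mxD !kconv_mxM -big_split /=.
by apply: eq_bigr => j _; rewrite kconv_mxD mulrDr.
Qed.

(* The empty X yields the zero ring, hence [pzRingType]. *)
HB.instance Definition _ := GRing.Zmodule_isPzRing.Build (kconv X)
  kconv_mulA kconv_mul1 kconv_mulr1 kconv_mulDl kconv_mulDr.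

End KleisliConvolution.

Record kconv_rep (R : pzRingType) := KConvRep {
  kconv_carrier : finType;
  kconv_map : {rmorphism R -> kconv kconv_carrier}
}.

Definition kconv_module (R : pzRingType) (P : kconv_rep R) : Type :=
  {ffun kconv_carrier P -> int}.
HB.instance Definition _ (R : pzRingType) (P : kconv_rep R) :=
  GRing.Zmodule.on (kconv_module P).

Section AssociatedModule.
Context (R : pzRingType) (P : kconv_rep R).
Implicit Types (r s : R) (v w : kconv_module P).

Definition kconv_act r v : kconv_module P :=
  [ffun i => \sum_j kconv_mx (kconv_map P r) i j * v j].

Lemma kconv_actA r s v : kconv_act r (kconv_act s v) = kconv_act (r * s) v.
Proof.
apply/ffunP => i; rewrite !ffunE rmorphM.
under eq_bigr do rewrite ffunE mulr_sumr.
rewrite exchange_big /=; apply: eq_bigr => k _.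
by rewrite kconv_mxM mulr_suml; apply: eq_bigr => j _; rewrite mulrA.
Qed.

Lemma kconv_act1 : left_id 1 kconv_act.
Proof.
move=> v; apply/ffunP => i; rewrite ffunE rmorph1 (bigD1 i) //=.
rewrite kconv_mx1 eqxx mul1r big1 ?addr0 // => k ki.
by rewrite kconv_mx1 eq_sym (negbTE ki) mul0r.
Qed.

Lemma kconv_actDr : right_distributive kconv_act +%R.
Proof.
move=> r v w; apply/ffunP => i; rewrite !ffunE -big_split /=.
by apply: eq_bigr => j _; rewrite ffunE mulrDr.
Qed.

Lemma kconv_actDl v : {morph kconv_act^~ v : r s / r + s}.
Proof.
move=> r s; apply/ffunP => i; rewrite !ffunE -big_split /=.
by apply: eq_bigr => j _; rewrite rmorphD kconv_mxD mulrDl.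
Qed.

HB.instance Definition _ := GRing.Zmodule_isLmodule.Build R (kconv_module P)
  kconv_actA kconv_act1 kconv_actDr kconv_actDl.

End AssociatedModule.

(* [GRing.submod_closed] for arbitrary, not necessarily decidable, subsets. *)
Definition is_submodule (R : pzRingType) (V : lmodType R) (S : V -> Prop) : Prop :=
  S 0 /\ (forall (a : R) (u v : V), S u -> S v -> S (a *: u + v)).

Definition simple_module (R : pzRingType) (V : lmodType R) : Prop :=
  (exists v : V, v <> 0) /\
  (forall S : V -> Prop, is_submodule S ->
     (forall v, S v <-> v = 0) \/ (forall v, S v)).

(* The zero representation is the one on the empty set. *)
Definition nonzero_rep (R : pzRingType) (P : kconv_rep R) : Prop :=
  (0 < #|kconv_carrier P|)%N.

Definition simple_rep (R : pzRingType) (P : kconv_rep R) : Prop :=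
  nonzero_rep P /\ simple_module (kconv_module P).

(* Main.v *)
Require Import Defs.
From mathcomp Require Import all_boot all_algebra.

(** The submodule [2M] of a simple module [M] is [0] or [M], so [M] is either
    killed by [2] or [2]-divisible as an Abelian group. The module of a nonzero
    representation is free of positive finite rank over the integers, and such
    a group is neither: the constant function [1] has a nonzero double and is
    not itself a double. *)

Import GRing.Theory.
Local Open Scope ring_scope.

(** Multiplication by [n] commutes with the scalars, even when the ring is not
    commutative, so its image is a submodule and simplicity applies to it. *)
Lemma simple_module_mulrn (R : pzRingType) (V : lmodType R) (n : nat) :
  simple_module V ->
  (forall v : V, v *+ n = 0) \/ (forall v : V, exists w : V, v = w *+ n).
Proof.
move=> [_ simpleV].
have subnV : is_submodule (fun v : V => exists w : V, v = w *+ n).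
  split; first by exists 0; rewrite mul0rn.
  by move=> a _ _ [u ->] [v ->]; exists (a *: u + v); rewrite mulrnDl scalerMnr.
have [nV0 | nV] := simpleV _ subnV; [left | by right].
by move=> v; apply/nV0; exists v.
Qed.

Theorem proposition5p17 (R : pzRingType) :
  ~ exists P : kconv_rep R, simple_rep P.
Proof.
move=> [P [/card_gt0P[x _] simpleM]].
pose one : kconv_module P := [ffun=> 1].
have [M2_0 | /(_ one)[w one_2w]] := simple_module_mulrn R (kconv_module P) 2 simpleM.
  by have /ffunP/(_ x) := M2_0 one; rewrite mulr2n !ffunE.
have /(congr1 (fun v : kconv_module P => odd `|v x|%N)) := one_2w.
by rewrite mulr2n !ffunE -mulr2n -mulr_natr abszM oddM andbF.
Qed.
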